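(* The space $\mathscr{F}\oplus\mathscr{E}$ is a Lie algebra, and there exists a Lie isomorphism $\psi$ from $\mathscr{F}\oplus\mathscr{E}$ onto a proper Lie subalgebra $\mathscr{L}_b$ of the Lie algebra $\mathscr{L}_{\rm BT}$ generated by two-dimensional Bogdanov–Takens singularities.
   Context: All vector fields are formal power series vector fields with real coefficients, with bracket $[v,w]=vw-wv$ (commutator of differential operators). On $\mathbb{R}^3$ with coordinates $(x,y,z)$ define $$F^l_k=x^l(y^2+z^2)^{k-l}\Big((k-l+1)x\tfrac{\partial}{\partial x}-\tfrac{l+1}{2}y\tfrac{\partial}{\partial y}-\tfrac{l+1}{2}z\tfrac{\partial}{\partial z}\Big)\quad(-1\le l\le k),$$ $$E^l_k=x^l(y^2+z^2)^{k-l}\Big(x\tfrac{\partial}{\partial x}+\tfrac12y\tfrac{\partial}{\partial y}+\tfrac12z\tfrac{\partial}{\partial z}\Big)\quad(0\le l\le k).$$ $\mathscr{F}$ is the space of all formal sums $a_0F^{-1}_0+\sum_{k\ge1,\,-1\le l\le k}a^l_kF^l_k$ and $\mathscr{E}$ is the space of all formal sums $\sum_{0\le l\le k,\ k+l\ge1}b^l_kE^l_k$ (real coefficients). A two-dimensional Bogdanov–Takens singularity is a formal vector field on $\mathbb{R}^2$, with coordinates $(\overline{x},\overline{y})$, of the form $w=-\overline{x}\frac{\partial}{\partial\overline{y}}+\text{h.o.t.}$, where h.o.t. denotes terms of degree at least two. $\mathscr{L}_{\rm BT}$ is the Lie algebra generated by all of these, i.e. the Lie algebra of formal planar vector fields vanishing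 at the origin whose linear part is a real multiple of $\overline{x}\frac{\partial}{\partial\overline{y}}$. *)

(* Defs.v *)
From HB Require Import structures.
From mathcomp Require Import all_boot all_order all_algebra.
From mathcomp Require Import all_classical reals.
From mathcomp Require Import mpoly.

Set Implicit Arguments.
Unset Strict Implicit.
Unset Printing Implicit Defensive.

Import GRing.Theory.

Local Open Scope ring_scope.
Local Open Scope classical_set_scope.

(* A series is its family of coefficients. [fps] is a separate constant so that
   it does not inherit the pointwise product of function spaces. *)
Definition fps (R : comNzRingType) (n : nat) : Type := 'X_{1..n} -> R.

HB.instance Definition _ (R : comNzRingType) (n : nat) :=
  GRing.Lmodule.copy (fps R n) ('X_{1..n} -> R^o).

Section Series.
Variables (R : comNzRingType) (n : nat).
Implicit Types (f g h : fps R n) (m : 'X_{1..n}).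

Definition fps_of_mpoly (p : {mpoly R[n]}) : fps R n := fun m => p@_m.

Definition fps_one : fps R n := fun m => (m == 0%MM)%:R.

(* Cauchy product; same shape as [mcoeffM]. *)
Definition fps_mul f g : fps R n := fun m =>
  \sum_(k : 'X_{1..n < (mdeg m).+1, (mdeg m).+1} | m == (k.1 + k.2)%MM)
     f k.1 * g k.2.

Definition fps_deriv (i : 'I_n) f : fps R n :=
  fun m => f (m + U_(i))%MM *+ (m i).+1.

Definition fps_trunc d f : {mpoly R[n]} :=
  \sum_(k : 'X_{1..n < d}) f k *: 'X_[k].

Lemma fps_truncE d f m : (mdeg m < d)%N -> (fps_trunc d f)@_m = f m.
Proof.
move=> md; rewrite /fps_trunc raddf_sum /= (bigD1 (BMultinom md)) //=.
rewrite mcoeffZ mcoeffX eqxx mulr1 big1 ?addr0 // => k kne.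
rewrite mcoeffZ mcoeffX; case: eqP => [km|]; last by rewrite mulr0.
by case/eqP: kne; apply/val_inj.
Qed.

Lemma fps_mulE f g (p q : {mpoly R[n]}) m :
    (forall k, (mdeg k <= mdeg m)%N -> p@_k = f k) ->
    (forall k, (mdeg k <= mdeg m)%N -> q@_k = g k) ->
  fps_mul f g m = (p * q)@_m.
Proof.
move=> pf qg; rewrite mcoeffM /fps_mul; apply: eq_bigr => k _.
by rewrite pf ?qg // -ltnS bmdeg.
Qed.

Lemma fps_mulC : commutative fps_mul.
Proof.
move=> f g; apply/funext => m; pose d := (mdeg m).+1.
have tr x k : (mdeg k <= mdeg m)%N -> (fps_trunc d x)@_k = x k.
  by move=> ?; apply: fps_truncE.
rewrite (@fps_mulE f g (fps_trunc d f) (fps_trunc d g)); [|exact: tr|exact: tr].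
rewrite (@fps_mulE g f (fps_trunc d g) (fps_trunc d f)); [|exact: tr|exact: tr].
by rewrite [in LHS]mulrC.
Qed.

Lemma fps_mulA : associative fps_mul.
Proof.
move=> f g h; apply/funext => m; pose d := (mdeg m).+1.
have tr x k : (mdeg k <= mdeg m)%N -> (fps_trunc d x)@_k = x k.
  by move=> ?; apply: fps_truncE.
have trM x y k : (mdeg k <= mdeg m)%N ->
    (fps_trunc d x * fps_trunc d y)@_k = fps_mul x y k.
  move=> km; symmetry; apply: fps_mulE => l lk; apply: tr; exact: leq_trans km.
rewrite (@fps_mulE f _ (fps_trunc d f) (fps_trunc d g * fps_trunc d h));
  [|exact: tr|exact: trM].
rewrite (@fps_mulE _ h (fps_trunc d f * fps_trunc d g) (fps_trunc d h));
  [|exact: trM|exact: tr].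
by rewrite [in LHS]mulrA.
Qed.

Lemma fps_mul1 : left_id fps_one fps_mul.
Proof.
move=> f; apply/funext => m; pose d := (mdeg m).+1.
rewrite (@fps_mulE _ f 1 (fps_trunc d f)) ?mul1r ?fps_truncE // => k kd;
  last exact: fps_truncE.
by rewrite mcoeff1.
Qed.

Lemma fps_mulDl : left_distributive fps_mul +%R.
Proof.
move=> f g h; apply/funext => m.
rewrite -[RHS]/(fps_mul f h m + fps_mul g h m) -big_split.
by apply: eq_bigr => k _; exact: mulrDl.
Qed.

Lemma fps_one_neq0 : fps_one != 0.
Proof.
apply/eqP => /(congr1 (fun f : fps R n => f 0%MM)) /eqP.
by rewrite /fps_one eqxx oner_eq0.
Qed.

HB.instance Definition _ := GRing.Zmodule_isComNzRing.Build (fps R n)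
  fps_mulA fps_mulC fps_mul1 fps_mulDl fps_one_neq0.

Lemma fps_derivB i f g : fps_deriv i (f - g) = fps_deriv i f - fps_deriv i g.
Proof. by apply/funext => m; rewrite /fps_deriv [LHS]mulrnBl. Qed.

Lemma fps_derivD i f g : fps_deriv i (f + g) = fps_deriv i f + fps_deriv i g.
Proof. by apply/funext => m; rewrite /fps_deriv [LHS]mulrnDl. Qed.

Lemma fps_derivM i f g :
  fps_deriv i (f * g) = fps_deriv i f * g + f * fps_deriv i g.
Proof.
apply/funext => m; pose d := (mdeg m).+2.
have tr x k : (mdeg k <= (mdeg m).+1)%N -> (fps_trunc d x)@_k = x k.
  by move=> ?; apply: fps_truncE.
have dU k : mdeg (k + U_(i))%MM = (mdeg k).+1 by rewrite mdegD mdeg1 addn1.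
have dr x k : (mdeg k <= mdeg m)%N ->
    (fps_trunc d x)^`M(i)@_k = fps_deriv i x k.
  by move=> km; rewrite mcoeff_deriv /fps_deriv tr ?dU.
rewrite -[LHS]/(fps_mul f g (m + U_(i))%MM *+ (m i).+1).
rewrite (@fps_mulE f g (fps_trunc d f) (fps_trunc d g)); last 2 first.
- by move=> k; rewrite dU; apply: tr.
- by move=> k; rewrite dU; apply: tr.
rewrite -mcoeff_deriv mderivM mcoeffD.
congr (_ + _); symmetry; apply: fps_mulE => k km;
  by [apply: dr|apply: tr; apply: leqW].
Qed.

Lemma fps_deriv_comm i j f :
  fps_deriv i (fps_deriv j f) = fps_deriv j (fps_deriv i f).
Proof.
apply/funext => m; rewrite /fps_deriv !mnmDE !mnm1E -!mulrnA eq_sym.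
case: eqP => [->|_] //; rewrite !addn0 mulnC.
by rewrite -!addmA [(U_(i) + _)%MM]addmC.
Qed.

End Series.

(* [v i] is the coefficient of d/dx_i. *)
Definition vfield (R : comNzRingType) (n : nat) : Type := 'I_n -> fps R n.

HB.instance Definition _ (R : comNzRingType) (n : nat) :=
  GRing.Lmodule.copy (vfield R n) ('I_n -> fps R n).

Section VectorFields.
Variables (R : comNzRingType) (n : nat).
Implicit Types (v w : vfield R n) (f : fps R n).

Definition vact v f : fps R n := \sum_(j < n) v j * fps_deriv j f.

(* The components of the operator [vw - wv], obtained by applying it to the
   coordinate functions; [vbracketE] shows that it is the full commutator. *)
Definition vbracket v w : vfield R n := fun i => vact v (w i) - vact w (v i).

Lemma vbracketE v w f :
  vact (vbracket v w) f = vact v (vact w f) - vact w (vact v f).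
Proof.
have dsum (i : 'I_n) (G : 'I_n -> fps R n) :
    fps_deriv i (\sum_j G j) = \sum_j fps_deriv i (G j).
  apply: (big_morph (fps_deriv i)); first exact: fps_derivD.
  by apply/funext => m; exact: mul0rn.
have E (a b : vfield R n) : vact a (vact b f) =
    \sum_i vact a (b i) * fps_deriv i f +
    \sum_i \sum_j a i * b j * fps_deriv i (fps_deriv j f).
  rewrite /vact; under eq_bigr do rewrite dsum mulr_sumr.
  under [X in _ = X + _]eq_bigr do rewrite mulr_suml.
  rewrite [X in _ = X + _]exchange_big -big_split; apply: eq_bigr => i _ /=.
  rewrite -big_split; apply: eq_bigr => j _ /=.
  by rewrite fps_derivM mulrDr !mulrA.
rewrite !E [X in _ - (_ + X)]exchange_big /=.
rewrite [X in _ - (_ + X)](_ : _ =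
  \sum_i \sum_j v i * w j * fps_deriv i (fps_deriv j f)); last first.
  by apply: eq_bigr => i _; apply: eq_bigr => j _;
    rewrite fps_deriv_comm (mulrC (w j)).
rewrite opprD addrACA subrr addr0 -sumrB /vact.
by apply: eq_bigr => i _; rewrite -mulrBl.
Qed.

Definition vfield_of_mpoly (p : 'I_n -> {mpoly R[n]}) : vfield R n :=
  fun i => fps_of_mpoly (p i).

(* [v] is the sum of the series [\sum_k u k]: every coefficient of the partial
   sums is eventually constant, equal to that of [v]. *)
Definition is_formal_sum (u : nat -> vfield R n) v : Prop :=
  forall (i : 'I_n) (m : 'X_{1..n}),
  exists N, forall K, (N <= K)%N -> (\sum_(k < K) u k) i m = v i m.

End VectorFields.

Section LieAlgebras.
Variable R : comNzRingType.

Record lie_algebra (V : lmodType R) (br : V -> V -> V) (L : set V) : Prop := {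
  lie0 : L 0;
  lie_linear : forall a u v, L u -> L v -> L (a *: u + v);
  lie_br : forall u v, L u -> L v -> L (br u v);
  lie_bilinearl : forall a u v w, L u -> L v -> L w ->
    br (a *: u + v) w = a *: br u w + br v w;
  lie_bilinearr : forall a u v w, L u -> L v -> L w ->
    br w (a *: u + v) = a *: br w u + br w v;
  lie_alternating : forall u, L u -> br u u = 0;
  lie_jacobi : forall u v w, L u -> L v -> L w ->
    br u (br v w) + br v (br w u) + br w (br u v) = 0
}.

Definition proper_lie_subalgebra (V : lmodType R) (br : V -> V -> V)
    (L M : set V) : Prop :=
  [/\ lie_algebra br M, lie_algebra br L & L `<` M].

Definition lie_generated (V : lmodType R) (br : V -> V -> V) (G : set V) :=
  smallest (lie_algebra br) G.

(* Only the restriction of [psi] to [L] is relevant. *)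
Record lie_isomorphism (U V : lmodType R) (brU : U -> U -> U)
    (brV : V -> V -> V) (L : set U) (M : set V) (psi : U -> V) : Prop := {
  lie_iso_bij : set_bij L M psi;
  lie_iso_linear : forall a u v, L u -> L v ->
    psi (a *: u + v) = a *: psi u + psi v;
  lie_iso_br : forall u v, L u -> L v -> psi (brU u v) = brV (psi u) (psi v)
}.

Definition sum_set (V : lmodType R) (A B : set V) : set V :=
  [set u | exists a b, [/\ A a, B b & u = a + b]].

End LieAlgebras.

Section HopfZero.
Variable R : realType.

Local Notation x := ('X_0 : {mpoly R[3]}).
Local Notation y := ('X_1 : {mpoly R[3]}).
Local Notation z := ('X_2 : {mpoly R[3]}).
Local Notation rho := (y ^+ 2 + z ^+ 2).

(* Meant for -1 <= l <= k, so that `|l + 1| = l + 1 and `|k - l| = k - l.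
   For l = -1 the d/dy and d/dz components vanish, because their factor
   (l + 1) / 2 does: x ^ l never occurs with a negative exponent. *)
Definition Ffield (l : int) (k : nat) : vfield R 3 :=
  vfield_of_mpoly (fun i =>
    [:: (k%:Z - l + 1)%:~R *: (x ^+ `|(l + 1)%R| * rho ^+ `|(k%:Z - l)%R|);
        - ((l + 1)%:~R / 2) *: (x ^+ `|l| * rho ^+ `|(k%:Z - l)%R| * y);
        - ((l + 1)%:~R / 2) *: (x ^+ `|l| * rho ^+ `|(k%:Z - l)%R| * z)]`_i).

Definition Efield (l k : nat) : vfield R 3 :=
  vfield_of_mpoly (fun i =>
    [:: x ^+ l * rho ^+ (k - l) * x;
        2^-1 *: (x ^+ l * rho ^+ (k - l) * y);
        2^-1 *: (x ^+ l * rho ^+ (k - l) * z)]`_i).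

(* In both spaces a monomial of degree d occurs only in the blocks k < d, so
   formal sums over all (l, k) may be grouped by k. *)
Definition Fblock (a : int -> nat -> R) (k : nat) : vfield R 3 :=
  if k is 0%N then a (-1) 0%N *: Ffield (-1) 0
  else \sum_(j < k.+2) a (j%:Z - 1) k *: Ffield (j%:Z - 1) k.

Definition Fspace : set (vfield R 3) :=
  [set v | exists a, is_formal_sum (Fblock a) v].

Definition Eblock (b : nat -> nat -> R) (k : nat) : vfield R 3 :=
  \sum_(l < k.+1 | (1 <= k + l)%N) b l k *: Efield l k.

Definition Espace : set (vfield R 3) :=
  [set v | exists b, is_formal_sum (Eblock b) v].

End HopfZero.

Arguments Fspace : clear implicits.
Arguments Espace : clear implicits.

Section BogdanovTakens.
Variable R : realType.

(* The coordinates are xbar = 'X_0 and ybar = 'X_1. *)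
Definition BT_linear : vfield R 2 :=
  vfield_of_mpoly (fun i => [:: 0; - 'X_0]`_i).

Definition BT_singularity : set (vfield R 2) :=
  [set w | exists h : vfield R 2,
     (forall i (m : 'X_{1..2}), (mdeg m < 2)%N -> h i m = 0) /\
     w = BT_linear + h].

Definition L_BT : set (vfield R 2) :=
  lie_generated (@vbracket R 2) BT_singularity.

End BogdanovTakens.

Arguments BT_linear : clear implicits.
Arguments BT_singularity : clear implicits.
Arguments L_BT : clear implicits.

(* Main.v *)
Require Import Defs.
From HB Require Import structures.
From mathcomp Require Import all_boot all_order all_algebra.
From mathcomp Require Import all_classical reals.
From mathcomp Require Import mpoly ring zify.

(** All the fields [F^l_k] and [E^l_k] have the shape
      [a(rho, x) d/dx + b(rho, x) / 2 * (y d/dy + z d/dz)],  [rho = y ^ 2 + z ^ 2],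
    called [radial a b] below. Such a field moves the two invariants [rho] and [x]
    of the rotations about the x-axis as functions of [rho] and [x] alone: it sends
    [rho] to [rho * b] and [x] to [a]. It is therefore related, through the map
    [(x, y, z) |-> (rho, x)], to the planar field
      [planar a b = xbar * b d/dxbar + a d/dybar],  [xbar = rho], [ybar = x],
    ([vact_radial]). Relatedness is compatible with brackets, and [planar a b]
    determines [a] and [b], so passing to the plane is an injective morphism of Lie
    algebras on radial fields. The map [meridian_proj] writes it as an explicit
    linear map on all of space: it looks at the derivatives of [rho] and [x] in the
    plane [z = 0], where a series in [rho] and [x] is recovered from its
    restriction ([pullbackK]).

    It remains to recognise the sum of the two spaces. In the plane, the [F^l_k] and
    [E^l_k] are homogeneous of degree [k + 1], and in every degree at least two they
    form a basis of the fields [planar a b]; in degree one only [rho d/dx] occurs.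
    Hence the sum is direct ([Fspace_Espace_disjoint]) and consists of the
    [radial a b] whose planar field vanishes at the origin with linear part a
    multiple of [xbar d/dybar] ([FE_sumP]). This condition is stable under brackets
    ([nilpotent_jet_br]). It defines a subspace of the Lie algebra generated by the
    Bogdanov-Takens singularities, since every field of order at least two is a
    difference of two singularities ([Lb_sub_L_BT]), and a proper one, since
    [ybar ^ 2 d/dxbar] is not of the form [planar a b] ([Lb_proper]). *)

Set Implicit Arguments.
Unset Strict Implicit.
Unset Printing Implicit Defensive.

Local Open Scope classical_set_scope.

(** * The algebra of formal power series *)

Section SeriesAlgebra.
Import GRing.Theory.
Local Open Scope ring_scope.
Variables (R : comNzRingType) (n : nat).
Implicit Types (f g : fps R n) (p q : {mpoly R[n]}) (m : 'X_{1..n}).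

Lemma fps_sumE I (r : seq I) (P : pred I) (F : I -> fps R n) m :
  (\sum_(i <- r | P i) F i) m = \sum_(i <- r | P i) F i m.
Proof. exact: (big_morph (fun f : fps R n => f m)). Qed.

Lemma fps_scaleAl (a : R) f g : a *: (f * g) = (a *: f) * g.
Proof.
apply/funext => m.
rewrite -[LHS]/(a * fps_mul f g m) -[RHS]/(fps_mul (a *: f) g m) /fps_mul.
by rewrite mulr_sumr; apply: eq_bigr => k _; rewrite mulrA.
Qed.

HB.instance Definition _ :=
  GRing.Lmodule_isLalgebra.Build R (fps R n) fps_scaleAl.
HB.instance Definition _ := GRing.Lalgebra_isComAlgebra.Build R (fps R n).

Lemma fps_deriv_is_linear i : linear (@fps_deriv R n i).
Proof.
move=> a f g; apply/funext => m.
rewrite -[RHS]/(a * (f (m + U_(i))%MM *+ (m i).+1) +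
  g (m + U_(i))%MM *+ (m i).+1).
by rewrite mulrnAr -mulrnDl.
Qed.

HB.instance Definition _ i := GRing.isLinear.Build R (fps R n) (fps R n) _
  (@fps_deriv R n i) (fps_deriv_is_linear i).

Lemma fps_of_mpoly_is_linear : linear (@fps_of_mpoly R n).
Proof. by move=> a p q; apply/funext => m; rewrite /fps_of_mpoly linearP. Qed.

Lemma fps_of_mpoly_is_monoid : monoid_morphism (@fps_of_mpoly R n).
Proof.
split=> [|p q]; apply/funext => m; first by rewrite /fps_of_mpoly mcoeff1.
exact/esym/fps_mulE.
Qed.

HB.instance Definition _ := GRing.isLinear.Build R {mpoly R[n]} (fps R n) _
  (@fps_of_mpoly R n) fps_of_mpoly_is_linear.
HB.instance Definition _ := GRing.isMonoidMorphism.Build {mpoly R[n]} (fps R n)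
  (@fps_of_mpoly R n) fps_of_mpoly_is_monoid.

Lemma fps_deriv_mpoly i p : fps_deriv i (fps_of_mpoly p) = fps_of_mpoly p^`M(i).
Proof. by apply/funext => m; rewrite /fps_of_mpoly mcoeff_deriv. Qed.

Lemma fps_mulXE i f m : (fps_of_mpoly 'X_i * f) (m + U_(i))%MM = f m.
Proof.
rewrite -[LHS]/(fps_mul _ _ _).
rewrite (@fps_mulE _ _ _ _ 'X_i (fps_trunc (mdeg m).+2 f)) //; last first.
  by move=> k; rewrite mdegD mdeg1 addn1 => km; rewrite fps_truncE.
by rewrite mulrC addmC mcoeffMX fps_truncE.
Qed.

Lemma fps_mulX_inj i : injective (fun f => fps_of_mpoly 'X_i * f).
Proof.
by move=> f g fg; apply/funext => m; rewrite -(fps_mulXE i f) fg fps_mulXE.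
Qed.

Lemma fps_mulX_eq0 i f m : m i = 0%N -> (fps_of_mpoly 'X_i * f) m = 0.
Proof.
move=> mi0; rewrite -[LHS]/(fps_mul _ f m) /fps_mul big1 // => k /eqP mk.
rewrite /fps_of_mpoly mcoeffX; case: eqP => [Uk|]; last by rewrite mul0r.
have := congr1 (fun e : 'X_{1..n} => e i) mk.
by rewrite /= mi0 mnmDE -Uk mnm1E eqxx.
Qed.

Definition ord_ge (d : nat) f := forall m, (mdeg m < d)%N -> f m = 0.

Lemma ord_geP d a f g : ord_ge d f -> ord_ge d g -> ord_ge d (a *: f + g).
Proof.
by move=> fd gd m md; rewrite -[LHS]/(a * f m + g m) fd // gd // mulr0 addr0.
Qed.

Lemma ord_ge0 f : ord_ge 0 f.
Proof. by move=> m; rewrite ltn0. Qed.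

Lemma ord_ge1P f : ord_ge 1 f <-> f 0%MM = 0.
Proof.
split=> [f1|f0 m]; first by rewrite f1 ?mdeg0.
by rewrite ltnS leqn0 mdeg_eq0 => /eqP ->.
Qed.

Lemma ord_geD d f g : ord_ge d f -> ord_ge d g -> ord_ge d (f + g).
Proof. by move=> fd gd; rewrite -[f]scale1r; apply: ord_geP. Qed.

Lemma ord_geB d f g : ord_ge d f -> ord_ge d g -> ord_ge d (f - g).
Proof. by move=> fd gd; rewrite addrC -scaleN1r; apply: ord_geP. Qed.

Lemma ord_ge_leq d e f : (d <= e)%N -> ord_ge e f -> ord_ge d f.
Proof. by move=> de fe m md; apply: fe; apply: leq_trans de. Qed.

Lemma ord_geM d e f g : ord_ge d f -> ord_ge e g -> ord_ge (d + e) (f * g).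
Proof.
move=> fd ge m mde; rewrite -[LHS]/(fps_mul f g m) /fps_mul big1 // => k /eqP mk.
have [kd|dk] := ltnP (mdeg k.1) d; first by rewrite fd ?mul0r.
rewrite ge ?mulr0 // -(ltn_add2l d); apply: leq_ltn_trans mde.
apply: leq_trans (eq_leq (esym (congr1 mdeg mk))).
by rewrite mdegD leq_add2r.
Qed.

Lemma ord_geX d f k : ord_ge d f -> ord_ge (d * k) (f ^+ k).
Proof.
move=> fd; elim: k => [|k IHk]; first by rewrite muln0; apply: ord_ge0.
by rewrite exprS mulnS; apply: ord_geM.
Qed.

Lemma ord_ge_prod I (r : seq I) (d : I -> nat) (F : I -> fps R n) :
  (forall i, ord_ge (d i) (F i)) ->
  ord_ge (\sum_(i <- r) d i)%N (\prod_(i <- r) F i).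
Proof.
move=> Fd; elim: r => [|i r IHr].
  by rewrite !big_nil; apply: ord_ge0.
by rewrite !big_cons; apply: ord_geM.
Qed.

End SeriesAlgebra.

(** * Substitution of polynomials into series *)

Section Substitution.
Import GRing.Theory.
Local Open Scope ring_scope.
Variables (R : comNzRingType) (n k : nat) (lq : n.-tuple {mpoly R[k]}).
Hypothesis lq0 : forall i, (tnth lq i)@_0 = 0.
Implicit Types (f g : fps R n) (p q : {mpoly R[n]}) (m : 'X_{1..k}).

(** Substituting the polynomials [lq] for the variables: as they have no constant
    term, a coefficient of the result is already that of a truncation. *)
Definition fps_subst f : fps R k :=
  fun m => (fps_trunc (mdeg m).+1 f \mPo lq)@_m.

Lemma ord_ge_comp d p :
  ord_ge d (fps_of_mpoly p) -> ord_ge d (fps_of_mpoly (p \mPo lq)).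
Proof.
move=> pd; rewrite comp_mpolyE raddf_sum /= => m md.
rewrite fps_sumE big_seq big1 // => e; rewrite mcoeff_msupp => pe.
have de : (d <= mdeg e)%N.
  rewrite leqNgt; apply: contraNN pe => ed.
  by rewrite -[_@__]/(fps_of_mpoly p e) pd.
suff prod0 : (\prod_(i < n) tnth lq i ^+ e i)@_m = 0.
  by rewrite /fps_of_mpoly mcoeffZ prod0 mulr0.
rewrite -[LHS]/(fps_of_mpoly _ m) rmorph_prod /=.
apply: (@ord_ge_prod R k _ (index_enum 'I_n) e) => [i|]; last first.
  by rewrite -mdegE; apply: leq_trans md de.
rewrite rmorphXn -[X in ord_ge X]mul1n; apply: ord_geX => l.
by rewrite ltnS leqn0 mdeg_eq0 => /eqP ->; apply: lq0.
Qed.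

(** Every polynomial that approximates [f] well enough computes the substitution;
    this transports the algebra of polynomial composition to series. *)
Lemma fps_substE f p m : (forall e, (mdeg e <= mdeg m)%N -> p@_e = f e) ->
  fps_subst f m = (p \mPo lq)@_m.
Proof.
move=> pf; apply/eqP; rewrite -subr_eq0 -mcoeffB -raddfB /=.
apply/eqP; apply: (@ord_ge_comp (mdeg m).+1) => // e em.
by rewrite /fps_of_mpoly mcoeffB fps_truncE // pf // subrr.
Qed.

Lemma fps_subst_mpoly p : fps_subst (fps_of_mpoly p) = fps_of_mpoly (p \mPo lq).
Proof. by apply/funext => m; apply: fps_substE. Qed.

Lemma fps_subst_linear : linear fps_subst.
Proof.
move=> a f g; apply/funext => m; pose T := @fps_trunc R n (mdeg m).+1.
rewrite (@fps_substE _ (a *: T f + T g)) => [|e em].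
  by rewrite comp_mpolyD comp_mpolyZ mcoeffD mcoeffZ.
by rewrite linearP /= !fps_truncE.
Qed.

Lemma fps_substM f g : fps_subst (f * g) = fps_subst f * fps_subst g.
Proof.
apply/funext => m; pose T := @fps_trunc R n (mdeg m).+1.
rewrite (@fps_substE _ (T f * T g)) => [|e em].
  rewrite rmorphM /=; symmetry; apply: fps_mulE => e em; symmetry;
    by apply: fps_substE => l le; rewrite fps_truncE // ltnS (leq_trans le).
symmetry; apply: fps_mulE => l le; rewrite fps_truncE // ltnS;
  exact: leq_trans em.
Qed.

(** Both sides are derivations over the composition morphism, so they agree as soon
    as they agree on the variables. *)
Lemma mderiv_comp i p :
  (p \mPo lq)^`M(i) = \sum_(j < n) (p^`M(j) \mPo lq) * (tnth lq j)^`M(i).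
Proof.
pose D q := \sum_(j < n) (q^`M(j) \mPo lq) * (tnth lq j)^`M(i).
have DM q r : D (q * r) = D q * (r \mPo lq) + (q \mPo lq) * D r.
  rewrite /D mulr_suml mulr_sumr -big_split; apply: eq_bigr => j _ /=.
  rewrite mderivM comp_mpolyD !rmorphM /= mulrDl.
  by rewrite mulrAC -!mulrA.
pose ok q := (q \mPo lq)^`M(i) = D q.
have okM q r : ok q -> ok r -> ok (q * r).
  by rewrite /ok DM rmorphM mderivM => -> ->.
have ok1 : ok 1.
  rewrite /ok rmorph1 -mpolyC1 mderivC /D big1 // => j _.
  by rewrite -mpolyC1 mderivC raddf0 mul0r.
have okX j : ok 'X_j.
  rewrite /ok comp_mpolyXU -tnth_nth /D (bigD1 j) //= mderivX mnm1E eqxx.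
  rewrite scale1r -{1}[U_(j)%MM]add0m addmK mpolyX0 rmorph1 mul1r.
  rewrite big1 ?addr0 // => l lj.
  by rewrite mderivX mnm1E eq_sym (negPf lj) scale0r raddf0 mul0r.
have okm (m : 'X_{1..n}) : ok 'X_[m].
  rewrite mpolyXE_id; apply: (big_ind ok) => // j _.
  by elim: (m j) => [|d IHd]; rewrite ?expr0 // exprS; apply: okM.
rewrite -/(D p) -/(ok p); elim/mpolyind: p => [|c m p _ _ IHp].
  by rewrite /ok raddf0 linear0 /D big1 // => j _; rewrite linear0 raddf0 mul0r.
rewrite /ok comp_mpolyD comp_mpolyZ mderivD mderivZ IHp okm /D scaler_sumr.
rewrite -big_split; apply: eq_bigr => j _ /=.
by rewrite mderivD mderivZ comp_mpolyD comp_mpolyZ mulrDl scalerAl.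
Qed.

Lemma fps_deriv_subst i f :
  fps_deriv i (fps_subst f) =
  \sum_(j < n) fps_subst (fps_deriv j f) * fps_of_mpoly (tnth lq j)^`M(i).
Proof.
apply/funext => m; pose T := fps_trunc (mdeg m).+2 f.
rewrite fps_sumE /fps_deriv (@fps_substE f T) => [|e]; last first.
  by rewrite mdegD mdeg1 addn1 => em; rewrite fps_truncE.
rewrite -mcoeff_deriv mderiv_comp raddf_sum /=; apply: eq_bigr => j _.
symmetry; apply: fps_mulE => // e em; symmetry; apply: fps_substE => l le.
rewrite mcoeff_deriv fps_truncE // mdegD mdeg1 addn1 !ltnS; exact: leq_trans em.
Qed.

Lemma vact_subst (v : vfield R k) f :
  vact v (fps_subst f) =
  \sum_(j < n) fps_subst (fps_deriv j f) * vact v (fps_of_mpoly (tnth lq j)).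
Proof.
rewrite /vact; under eq_bigr do rewrite fps_deriv_subst mulr_sumr.
rewrite exchange_big; apply: eq_bigr => j _ /=; rewrite mulr_sumr.
by apply: eq_bigr => i _; rewrite fps_deriv_mpoly mulrCA.
Qed.

Lemma ord_ge_subst d f : ord_ge d f -> ord_ge d (fps_subst f).
Proof.
move=> fd m md; rewrite (@fps_substE _ 0) ?linear0 ?mcoeff0 // => e em.
by rewrite mcoeff0 fd // (leq_ltn_trans em).
Qed.

End Substitution.

(** * Lie algebras of formal vector fields *)

Section VectorFieldAlgebra.
Import GRing.Theory.
Local Open Scope ring_scope.
Variables (R : comNzRingType) (n : nat).
Implicit Types (u v w : vfield R n) (f g : fps R n).

Lemma vact_linear v : linear (vact v).
Proof.
move=> a f g; rewrite /vact scaler_sumr -big_split; apply: eq_bigr => j _ /=.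
by rewrite linearP mulrDr scalerAr.
Qed.

HB.instance Definition _ v :=
  GRing.isLinear.Build R (fps R n) (fps R n) _ (vact v) (vact_linear v).

Lemma vact_linearl a u v f : vact (a *: u + v) f = a *: vact u f + vact v f.
Proof.
rewrite /vact scaler_sumr -big_split; apply: eq_bigr => j _ /=.
by rewrite -[(a *: u + v) j]/(a *: u j + v j) mulrDl scalerAl.
Qed.

Lemma vactM v f g : vact v (f * g) = vact v f * g + f * vact v g.
Proof.
rewrite /vact mulr_suml mulr_sumr -big_split; apply: eq_bigr => j _ /=.
by rewrite fps_derivM; ring.
Qed.

Lemma vactX v i : vact v (fps_of_mpoly 'X_i) = v i.
Proof.
rewrite /vact (bigD1 i) //= fps_deriv_mpoly mderivX mnm1E eqxx scale1r.
rewrite -{1}[U_(i)%MM]add0m addmK mpolyX0 rmorph1 mulr1 big1 ?addr0 // => j ji.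
by rewrite fps_deriv_mpoly mderivX mnm1E eq_sym (negPf ji) scale0r raddf0 mulr0.
Qed.

Lemma vbracket_linearl a u v w :
  vbracket (a *: u + v) w = a *: vbracket u w + vbracket v w.
Proof.
apply/funext => i; rewrite /vbracket vact_linearl.
rewrite -[(a *: u + v) i]/(a *: u i + v i) linearP.
rewrite -[RHS]/(a *: (vact u (w i) - vact w (u i)) +
  (vact v (w i) - vact w (v i))).
by rewrite scalerBr opprD addrACA.
Qed.

Lemma vbracketC u v : vbracket u v = - vbracket v u.
Proof. by apply/funext => i; rewrite -[RHS]/(- (_ - _)) opprB. Qed.

Lemma vbracket_linearr a u v w :
  vbracket w (a *: u + v) = a *: vbracket w u + vbracket w v.
Proof.
by rewrite vbracketC vbracket_linearl opprD -scalerN -!(vbracketC w).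
Qed.

Lemma vbracketvv u : vbracket u u = 0.
Proof. by apply/funext => i; rewrite /vbracket subrr. Qed.

(** Holds because the bracket is the commutator of the operators [vact]. *)
Lemma vbracket_jacobi u v w :
  vbracket u (vbracket v w) + vbracket v (vbracket w u) +
  vbracket w (vbracket u v) = 0.
Proof.
have E (a b c : vfield R n) i : vbracket a (vbracket b c) i =
    vact a (vact b (c i)) - vact a (vact c (b i)) -
    (vact b (vact c (a i)) - vact c (vact b (a i))).
  by rewrite {1}/vbracket vbracketE [vact a _]raddfB.
apply/funext => i.
rewrite -[LHS]/(vbracket u _ i + vbracket v _ i + vbracket w _ i) !E.
by rewrite -[RHS]/(0 : fps R n); ring.
Qed.

Lemma vfield_lie_algebra (L : set (vfield R n)) :
  L 0 -> (forall a u v, L u -> L v -> L (a *: u + v)) ->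
  (forall u v, L u -> L v -> L (vbracket u v)) ->
  lie_algebra (@vbracket R n) L.
Proof.
move=> L0 Llin Lbr; split=> // *; [exact: vbracket_linearl|exact: vbracket_linearr
  |exact: vbracketvv|exact: vbracket_jacobi].
Qed.

Lemma lie_generated_vfield (G : set (vfield R n)) :
  lie_algebra (@vbracket R n) (lie_generated (@vbracket R n) G).
Proof.
apply: vfield_lie_algebra => [|a u v Lu Lv|u v Lu Lv] M [lieM GM].
- exact: lie0 lieM.
- by apply: (lie_linear lieM); [apply: Lu|apply: Lv].
- by apply: (lie_br lieM); [apply: Lu|apply: Lv].
Qed.

Lemma formal_sum_unique (s : nat -> vfield R n) u v :
  is_formal_sum s u -> is_formal_sum s v -> u = v.
Proof.
move=> su sv; apply/funext => i; apply/funext => m.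
have [N uN] := su i m; have [N' vN] := sv i m.
by rewrite -(uN (maxn N N')) ?leq_maxl // -(vN (maxn N N')) ?leq_maxr.
Qed.

End VectorFieldAlgebra.

(** * Planar series by degree *)

Section PlanarSeries.
Import GRing.Theory.
Local Open Scope ring_scope.
Variable R : comNzRingType.
Implicit Types (f g : fps R 2) (m : 'X_{1..2}).

Lemma forall_ord2 (P : 'I_2 -> Prop) : P 0 -> P 1 -> forall i, P i.
Proof.
by move=> P0 P1 [[|[|//]] lti]; [move: P0|move: P1]; congr P; exact: val_inj.
Qed.

Lemma forall_ord3 (P : 'I_3 -> Prop) : P 0 -> P 1 -> P 2%:R -> forall i, P i.
Proof.
by move=> P0 P1 P2 [[|[|[|//]]] lti]; [move: P0|move: P1|move: P2]; congr P;
  exact: val_inj.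
Qed.

Lemma sum_ord2 (V : nmodType) (F : 'I_2 -> V) : \sum_i F i = F 0 + F 1.
Proof.
rewrite !big_ord_recl big_ord0 addr0.
by congr (F _ + F _); exact: val_inj.
Qed.

Lemma mdeg2 m : mdeg m = (m 0%R + m 1%R)%N.
Proof.
by rewrite mdegE !big_ord_recl big_ord0 addn0; congr (m _ + m _)%N;
  exact: val_inj.
Qed.

Definition homog_part d f : fps R 2 := fun m => if mdeg m == d then f m else 0.

Lemma eq_homog_part d f g :
  (forall m, mdeg m = d -> f m = g m) -> homog_part d f = homog_part d g.
Proof.
by move=> fg; apply/funext => m; rewrite /homog_part; case: eqP => // /fg.
Qed.

Lemma mcoeff_mon2 i j m :
  ('X_1 ^+ j * 'X_0 ^+ i : {mpoly R[2]})@_m = ((m 0%R == i) && (m 1%R == j))%:R.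
Proof.
rewrite !mpolyXn -mpolyXD mcoeffX; congr (_%:R); congr nat_of_bool.
apply/eqP/andP => [<-|[/eqP mi /eqP mj]].
  by rewrite !(mnmDE, mulmnE, mnm1E) /=; split; apply/eqP; lia.
apply/mnmP; apply: forall_ord2; rewrite !(mnmDE, mulmnE, mnm1E) /=; lia.
Qed.

(** Degree [d] contains exactly one monomial for each exponent [j] of the second
    variable, so its coefficients form a function of [j] alone. *)
Lemma homog_part_sum d (c : nat -> R) :
  \sum_(j < d.+1) c j *: fps_of_mpoly ('X_1 ^+ j * 'X_0 ^+ (d - j)) =
  homog_part d (fun m => c (m 1)).
Proof.
apply/funext => m; rewrite fps_sumE /homog_part.
have E (j : 'I_d.+1) : (c j *: fps_of_mpoly ('X_1 ^+ j * 'X_0 ^+ (d - j))) m =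
    c j * ((m 0%R == d - j)%N && (m 1%R == j))%:R.
  by rewrite -[LHS]/(c j * _) /fps_of_mpoly mcoeff_mon2.
under eq_bigr do rewrite E; rewrite mdeg2; case: eqP => md.
  have m1d : (m 1%R < d.+1)%N by lia.
  rewrite (bigD1 (Ordinal m1d)) //= big1 => [|j /eqP jm].
    by rewrite eqxx (_ : m 0 == _) ?mulr1 ?addr0 //; apply/eqP; lia.
  case: eqP => [m0|]; case: eqP => [m1|] //=; rewrite ?mulr0 //.
  by case: jm; apply: val_inj.
rewrite big1 // => j _; case: eqP => [m0|]; case: eqP => [m1|] //=;
  rewrite ?mulr0 //; case: md; have := ltn_ord j; lia.
Qed.

Lemma subU1K m : m 1 != 0%N -> (m - U_(1) + U_(1))%MM = m.
Proof.
move=> m1; apply: submK; apply/mnm_lepP; apply: forall_ord2; rewrite mnm1E //.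
by rewrite eqxx lt0n.
Qed.

Lemma multinom2 m : m = [multinom nth 0%N [:: m 0%R; m 1%R] i | i < 2].
Proof. by apply/mnmP; apply: forall_ord2; rewrite mnmE. Qed.

End PlanarSeries.

(** * Radial vector fields and their planar counterparts *)

Section RadialFields.
Import GRing.Theory Num.Theory.
Local Open Scope ring_scope.
Variable R : numFieldType.
Implicit Types (f g A B : fps R 2) (m : 'X_{1..2}).

Local Notation x := ('X_0 : {mpoly R[3]}).
Local Notation y := ('X_1 : {mpoly R[3]}).
Local Notation z := ('X_2 : {mpoly R[3]}).

(** The two basic invariants [rho = y ^ 2 + z ^ 2] and [x] of the rotations about
    the x-axis, in the order in which they become the coordinates [xbar], [ybar]
    of the plane. *)
Definition cyl : 2.-tuple {mpoly R[3]} := [tuple y ^+ 2 + z ^+ 2; x].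

Lemma cyl_mcoeff0 i : (tnth cyl i)@_0 = 0.
Proof.
move: i; apply: forall_ord2; rewrite (tnth_nth 0) /=.
  have E (j : 'I_3) : (U_(j) *+ 2)%MM == 0%MM = false.
    by rewrite -mdeg_eq0 mdegMn mdeg1.
  by rewrite mcoeffD !mcoeffXn !E addr0.
by rewrite mcoeffX -mdeg_eq0 mdeg1.
Qed.

Definition pullback (f : fps R 2) : fps R 3 := fps_subst cyl f.

Lemma pullback_linear : linear pullback.
Proof. exact/fps_subst_linear/cyl_mcoeff0. Qed.

HB.instance Definition _ := GRing.isLinear.Build R (fps R 2) (fps R 3) _
  pullback pullback_linear.

Lemma pullbackM f g : pullback (f * g) = pullback f * pullback g.
Proof. exact/fps_substM/cyl_mcoeff0. Qed.

Lemma pullback_mpoly (p : {mpoly R[2]}) :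
  pullback (fps_of_mpoly p) = fps_of_mpoly (p \mPo cyl).
Proof. exact/fps_subst_mpoly/cyl_mcoeff0. Qed.

Lemma pullback_X0 :
  pullback (fps_of_mpoly 'X_0) = fps_of_mpoly (y ^+ 2 + z ^+ 2).
Proof. by rewrite pullback_mpoly comp_mpolyXU. Qed.

Lemma pullback_X1 : pullback (fps_of_mpoly 'X_1) = fps_of_mpoly x.
Proof. by rewrite pullback_mpoly comp_mpolyXU. Qed.

Lemma vact_pullback v f :
  vact v (pullback f) =
    pullback (fps_deriv 0 f) * vact v (pullback (fps_of_mpoly 'X_0)) +
    pullback (fps_deriv 1 f) * vact v (pullback (fps_of_mpoly 'X_1)).
Proof.
rewrite {1}/pullback vact_subst; last exact: cyl_mcoeff0.
by rewrite sum_ord2 pullback_X0 pullback_X1 !(tnth_nth 0).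
Qed.

(** Restricting a series to [z = 0] and reading [y ^ 2] as [xbar] inverts
    [pullback], because a rotation-invariant function is determined by its values
    on a half-plane bounded by the axis. On coefficients, [xbar ^ i ybar ^ j] reads
    off [x ^ j y ^ (2 i)]. *)
Definition half_plane_exp m : 'X_{1..3} :=
  [multinom nth 0%N [:: m 1%R; (m 0%R).*2; 0%N] i | i < 3].

Definition half_plane (g : fps R 3) : fps R 2 := fun m => g (half_plane_exp m).

Lemma half_plane_linear : linear half_plane.
Proof. by []. Qed.

HB.instance Definition _ := GRing.isLinear.Build R (fps R 3) (fps R 2) _
  half_plane half_plane_linear.

Lemma mcoeff_cyl (e m : 'X_{1..2}) :
  ('X_[e] \mPo cyl)@_(half_plane_exp m) = (e == m)%:R.
Proof.
rewrite comp_mpolyX !big_ord_recl big_ord0 mulr1 !(tnth_nth 0) /=.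
(* Only the term of the binomial expansion without [z] can contribute. *)
rewrite exprDn mulr_suml raddf_sum /= big_ord_recl big1 ?addr0 => [|i _].
  rewrite subn0 expr0 mulr1 bin0 mulr1n !mpolyXn -mpolyXD mcoeffX.
  have -> : lift ord0 ord0 = 1 :> 'I_2 by exact: val_inj.
  have -> : ord0 = 0 :> 'I_2 by exact: val_inj.
  congr (_%:R); congr nat_of_bool; apply/eqP/eqP => /mnmP E; apply/mnmP.
    apply: forall_ord2; [have := E 1|have := E 0];
      by rewrite !(mnmDE, mulmnE, mnm1E) mnmE /=; lia.
  move=> i; move: i; apply: forall_ord3;
    by rewrite !(mnmDE, mulmnE, mnm1E) mnmE /= -?E; lia.
rewrite mulrnAl !mpolyXn -!mpolyXD mcoeffMn mcoeffX.
case: eqP => [/mnmP/(_ 2%:R)|_]; rewrite ?mul0rn //.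
by rewrite !(mnmDE, mulmnE, mnm1E) mnmE /= /bump /=; lia.
Qed.

Lemma pullbackK : cancel pullback half_plane.
Proof.
move=> f; apply/funext => m; rewrite /half_plane /pullback.
have E (p : {mpoly R[2]}) : (p \mPo cyl)@_(half_plane_exp m) = p@_m.
  rewrite comp_mpolyEX [in RHS](mpolyE p) !raddf_sum /=.
  by apply: eq_bigr => e _; rewrite !mcoeffZ mcoeff_cyl mcoeffX.
have mm : (mdeg m <= mdeg (half_plane_exp m))%N.
  rewrite mdeg2 (mdegE (half_plane_exp m)) !big_ord_recl big_ord0 !mnmE /=.
  by lia.
by rewrite /fps_subst E fps_truncE.
Qed.

(** The field [pullback A * d/dx + pullback B / 2 * (y d/dy + z d/dz)]. The factor
    1/2 compensates the derivative of [y ^ 2 + z ^ 2], so that in the coordinates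
    [rho = y ^ 2 + z ^ 2] and [x] it reads [A d/dx + rho * B d/drho]. *)
Definition radial A B : vfield R 3 := fun i =>
  nth 0 [:: pullback A; 2^-1 *: (pullback B * fps_of_mpoly y);
            2^-1 *: (pullback B * fps_of_mpoly z)] i.

(** The same field in the plane: [xbar] stands for [rho] and [ybar] for [x]. *)
Definition planar A B : vfield R 2 := fun i =>
  nth 0 [:: fps_of_mpoly 'X_0 * B; A] i.

Lemma radial_linear a A B A' B' :
  radial (a *: A + A') (a *: B + B') = a *: radial A B + radial A' B'.
Proof.
apply/funext; apply: forall_ord3;
  rewrite -[RHS]/(a *: radial A B _ + radial A' B' _) /radial /= linearP //;
  by rewrite mulrDl scalerDr -scalerAl !scalerA mulrC.
Qed.

Lemma radialD A B A' B' :
  radial (A + A') (B + B') = radial A B + radial A' B'.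
Proof. by have := radial_linear 1 A B A' B'; rewrite !scale1r. Qed.

Lemma radial0 : radial 0 0 = 0.
Proof.
apply/funext; apply: forall_ord3; rewrite /radial /= linear0 //;
  by rewrite mul0r scaler0.
Qed.

Lemma radialZ a A B : radial (a *: A) (a *: B) = a *: radial A B.
Proof. by rewrite -[RHS]addr0 -radial0 -radial_linear !addr0. Qed.

Lemma ord_ge_radial d A B i :
  ord_ge d A -> ord_ge d B -> ord_ge d (radial A B i).
Proof.
move=> Ad Bd; have pullback_ord f : ord_ge d f -> ord_ge d (pullback f).
  by apply: ord_ge_subst; exact: cyl_mcoeff0.
have comp_ord (p : {mpoly R[3]}) :
    ord_ge d ((2^-1 : R) *: (pullback B * fps_of_mpoly p)).
  rewrite -[_ *: _]addr0; apply: ord_geP => //.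
  by rewrite -[d]addn0; apply: ord_geM; [exact: pullback_ord|exact: ord_ge0].
by move: i; apply: forall_ord3; [exact: pullback_ord|exact: comp_ord..].
Qed.

Let halves (f : fps R 3) : (2^-1 : R) *: f + (2^-1 : R) *: f = f.
Proof. by rewrite -scalerDl -[2^-1]mul1r -splitr scale1r. Qed.

(** [radial A B] and [planar A B] are related by the map [(x, y, z) |-> (rho, x)].
    By the chain rule this needs checking on the two coordinates only. *)
Lemma vact_radial A B f :
  vact (radial A B) (pullback f) = pullback (vact (planar A B) f).
Proof.
have v0 : vact (radial A B) (pullback (fps_of_mpoly 'X_0)) =
    pullback (B * fps_of_mpoly 'X_0).
  rewrite pullbackM pullback_X0 rmorphD /= !rmorphXn /= !expr2 /= linearD /=.
  rewrite !vactM !vactX /radial /= !(mulrC (fps_of_mpoly _) (_ *: _)).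
  by rewrite -!scalerAl !halves -!mulrA mulrDr.
have v1 : vact (radial A B) (pullback (fps_of_mpoly 'X_1)) = pullback A.
  by rewrite pullback_X1 vactX.
rewrite vact_pullback v0 v1 -!pullbackM -linearD /vact sum_ord2 /planar /=.
by congr pullback; ring.
Qed.

(** In the last two components the terms in which a field differentiates the
    factor [y] or [z] are symmetric in the two fields, hence cancel. *)
Lemma vbracket_radial A B A' B' :
  vbracket (radial A B) (radial A' B') =
  radial (vact (planar A B) A' - vact (planar A' B') A)
         (vact (planar A B) B' - vact (planar A' B') B).
Proof.
apply/funext; rewrite /vbracket; apply: forall_ord3.
- by rewrite -!/(pullback _) !vact_radial -linearB.
- have E (C D : fps R 2) :
    radial C D 1 = 2^-1 *: (pullback D * fps_of_mpoly y) by [].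
  rewrite !E !linearZ /= !vactM !vact_radial !vactX !E linearB /= mulrBl -scalerDr.
  congr (_ *: _); rewrite -!scalerAr [pullback B' * (_ * _)]mulrCA; ring.
- have E (C D : fps R 2) :
    radial C D 2%:R = 2^-1 *: (pullback D * fps_of_mpoly z) by [].
  rewrite !E !linearZ /= !vactM !vact_radial !vactX !E linearB /= mulrBl -scalerDr.
  congr (_ *: _); rewrite -!scalerAr [pullback B' * (_ * _)]mulrCA; ring.
Qed.

(** The motion that [v] induces on the coordinates [rho] and [x], observed on the
    half-plane. It is linear on all fields and inverts [radial], up to the change
    of coordinates. *)
Definition meridian_proj (v : vfield R 3) : vfield R 2 :=
  fun i => half_plane (vact v (pullback (fps_of_mpoly 'X_i))).

Lemma meridian_proj_linear a u v :
  meridian_proj (a *: u + v) = a *: meridian_proj u + meridian_proj v.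
Proof.
by apply/funext => i; rewrite /meridian_proj vact_linearl linearP.
Qed.

Lemma meridian_proj_radial A B : meridian_proj (radial A B) = planar A B.
Proof.
by apply/funext => i; rewrite /meridian_proj vact_radial pullbackK vactX.
Qed.

Lemma meridian_proj_br A B A' B' :
  meridian_proj (vbracket (radial A B) (radial A' B')) =
  vbracket (planar A B) (planar A' B').
Proof.
apply/funext => i; rewrite /meridian_proj vbracketE !vact_radial linearB /=.
by rewrite !pullbackK !vactX.
Qed.

Lemma planar_inj A B A' B' : planar A B = planar A' B' -> A = A' /\ B = B'.
Proof.
move=> E; split; first exact: (congr1 (fun v => v 1) E).
exact: (fps_mulX_inj (congr1 (fun v => v 0) E)).
Qed.

Lemma radial_inj A B A' B' : radial A B = radial A' B' -> A = A' /\ B = B'.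
Proof.
move/(congr1 meridian_proj); rewrite !meridian_proj_radial.
exact: planar_inj.
Qed.

End RadialFields.

(** * The spaces of formal sums as radial vector fields *)

Section HopfZeroSpaces.
Import GRing.Theory Num.Theory.
Local Open Scope ring_scope.
Variable R : realType.
Implicit Types (A B : fps R 2) (m : 'X_{1..2}).

Lemma radial_sum (I : Type) (r : seq I) (A B : I -> fps R 2) :
  \sum_(i <- r) radial (A i) (B i) =
  radial (\sum_(i <- r) A i) (\sum_(i <- r) B i).
Proof.
elim: r => [|i r IHr]; first by rewrite !big_nil radial0.
by rewrite !big_cons IHr radialD.
Qed.

(** [pullback] doubles the degree in [rho] and never lowers a degree, so each
    coefficient of [radial A B] sees finitely many homogeneous parts. The grading
    is that of the blocks: the d/dx component of a block has degree one more than
    the common factor of the other two. *)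
Lemma radial_formal_sum A B : A 0%MM = 0 ->
  is_formal_sum (fun k => radial (homog_part k.+1 A) (homog_part k B))
    (radial A B).
Proof.
move=> A0 i m; exists (mdeg m).+1 => K mK.
rewrite radial_sum; apply/eqP; rewrite -subr_eq0; apply/eqP.
set A' := \sum_(k < K) _; set B' := \sum_(k < K) _.
have -> : radial A' B' i m - radial A B i m =
    radial (-1 *: A + A') (-1 *: B + B') i m.
  rewrite radial_linear -[RHS]/((-1) * radial A B i m + radial A' B' i m).
  by rewrite mulN1r addrC.
apply: (@ord_ge_radial _ (mdeg m).+1) => // e em;
  rewrite -[LHS]/((-1) * _ + _) mulN1r.
  rewrite /A' fps_sumE.
  have [->|e0] := eqVneq e 0%MM.
    by rewrite A0 oppr0 add0r big1 // => k _; rewrite /homog_part mdeg0.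
  have lt_eK : ((mdeg e).-1 < K)%N by lia.
  have eP : (0 < mdeg e)%N by rewrite lt0n mdeg_eq0.
  rewrite (bigD1 (Ordinal lt_eK)) //= /homog_part prednK // eqxx addKr.
  apply: big1 => k /eqP ke; case: eqP => // ek; case: ke; apply: val_inj => /=.
  by rewrite ek.
rewrite /B' fps_sumE.
have lt_eK : (mdeg e < K)%N by lia.
rewrite (bigD1 (Ordinal lt_eK)) //= /homog_part eqxx addKr.
by apply: big1 => k /eqP ke; case: eqP => // ek; case: ke; apply: val_inj.
Qed.

Lemma pullback_mon i j :
  pullback (fps_of_mpoly ('X_1 ^+ i * 'X_0 ^+ j)) =
  fps_of_mpoly ('X_0 ^+ i * ('X_1 ^+ 2 + 'X_2 ^+ 2) ^+ j : {mpoly R[3]}).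
Proof. by rewrite pullback_mpoly rmorphM !rmorphXn /= !comp_mpolyXU. Qed.

Lemma Ffield_radial (l : int) k :
  Ffield R l k =
  radial ((k%:Z - l + 1)%:~R *:
            fps_of_mpoly ('X_1 ^+ `|(l + 1)%R| * 'X_0 ^+ `|(k%:Z - l)%R|))
         (- (l + 1)%:~R *:
            fps_of_mpoly ('X_1 ^+ `|l| * 'X_0 ^+ `|(k%:Z - l)%R|)).
Proof.
apply/funext; apply: forall_ord3;
  rewrite /Ffield /vfield_of_mpoly /radial /= [pullback _]linearZ /= pullback_mon.
- by rewrite linearZ.
- by rewrite -scalerAl scalerA mulrN mulrC linearZ /= -rmorphM.
- by rewrite -scalerAl scalerA mulrN mulrC linearZ /= -rmorphM.
Qed.

Lemma Efield_radial l k : Efield R l k =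
  radial (fps_of_mpoly ('X_1 ^+ l.+1 * 'X_0 ^+ (k - l)))
         (fps_of_mpoly ('X_1 ^+ l * 'X_0 ^+ (k - l))).
Proof.
apply/funext; apply: forall_ord3;
  rewrite /Efield /vfield_of_mpoly /radial /= pullback_mon.
- by rewrite [_ ^+ l.+1]exprS -[in RHS]mulrA mulrC.
- by rewrite linearZ /= -rmorphM.
- by rewrite linearZ /= -rmorphM.
Qed.

(** The coefficient of [F^(j-1)_k], indexed by [j] from 0 so that all families of
    indices are natural numbers; the absent field [F^0_0] gets coefficient 0. *)
Definition Fcoef (a : int -> nat -> R) (j k : nat) : R :=
  if j is l.+1 then if (k + l == 0)%N then 0 else a l k else a (-1) k.

(** [Fx], [Fr] (and [Ex], [Er] for the other space) are the two planar series of
    a formal sum: in the coordinates [(rho, x)], [F^l_k] is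
    [x ^ l rho ^ (k - l) ((k - l + 1) x d/dx - (l + 1) rho d/drho)] and [E^l_k] is
    [x ^ l rho ^ (k - l) (x d/dx + rho d/drho)]. *)
Definition Fx a : fps R 2 := fun m =>
  if mdeg m is k.+1 then (m 0).+1%:R * Fcoef a (m 1) k else 0.

Definition Fr a : fps R 2 := fun m =>
  - ((m 1).+1%:R * Fcoef a (m 1).+1 (mdeg m)).

(** The Euler field [E^0_0] is absent, whence the guard. *)
Definition Ecoef (b : nat -> nat -> R) (l k : nat) : R :=
  if (0 < k + l)%N then b l k else 0.

Definition Ex b : fps R 2 := fun m =>
  if m 1 is l.+1 then Ecoef b l (mdeg m).-1 else 0.

Definition Er b : fps R 2 := fun m => Ecoef b (m 1) (mdeg m).

Lemma Fblock_radial a k :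
  Fblock a k = radial (homog_part k.+1 (Fx a)) (homog_part k (Fr a)).
Proof.
have -> : Fblock a k = \sum_(j < k.+2) Fcoef a j k *: Ffield R (j%:Z - 1) k.
  case: k => [|k].
    by rewrite /Fblock big_ord_recl big_ord1 /Fcoef /= scale0r addr0.
  rewrite /Fblock; apply: eq_bigr => -[[|l] lk] _ //=.
  by congr (a _ _ *: _); lia.
have E (j : 'I_k.+2) : Fcoef a j k *: Ffield R (j%:Z - 1) k =
    radial ((Fcoef a j k * (k.+2 - j)%:R) *:
              fps_of_mpoly ('X_1 ^+ j * 'X_0 ^+ (k.+1 - j)))
           ((- (j%:R * Fcoef a j k)) *:
              fps_of_mpoly ('X_1 ^+ j.-1 * 'X_0 ^+ (k.+1 - j))).
  rewrite Ffield_radial subrK absz_nat.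
  have jk := ltn_ord j.
  have -> : `|(k%:Z - (j%:Z - 1))%R|%N = (k.+1 - j)%N by lia.
  have -> : (k%:Z - (j%:Z - 1) + 1) = (k.+2 - j)%N%:Z by lia.
  rewrite -radialZ !scalerA.
  rewrite mulrN [_ * Fcoef a j k]mulrC.
  case: (nat_of_ord j) jk => [|l] _; first by rewrite !mulr0 !oppr0 !scale0r.
  by rewrite (_ : `|(l.+1%:Z - 1)%R|%N = l) //; lia.
rewrite (eq_bigr _ (fun j _ => E j)) radial_sum; congr radial.
  rewrite (homog_part_sum k.+1 (fun j => Fcoef a j k * (k.+2 - j)%:R)).
  apply: eq_homog_part => m mk; rewrite /Fx mk mulrC; congr (_%:R * _).
  by move: mk; rewrite mdeg2; lia.
rewrite big_ord_recl mul0r oppr0 scale0r add0r.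
rewrite (homog_part_sum k (fun l => - (l.+1%:R * Fcoef a l.+1 k))).
by apply: eq_homog_part => m mk; rewrite /Fr mk.
Qed.

Lemma Eblock_radial b k :
  Eblock b k = radial (homog_part k.+1 (Ex b)) (homog_part k (Er b)).
Proof.
have -> : Eblock b k = \sum_(l < k.+1) Ecoef b l k *: Efield R l k.
  rewrite /Eblock big_mkcond; apply: eq_bigr => l _ /=.
  by rewrite /Ecoef; case: ifP; rewrite // scale0r.
have E (l : 'I_k.+1) : Ecoef b l k *: Efield R l k =
    radial (Ecoef b l k *: fps_of_mpoly ('X_1 ^+ l.+1 * 'X_0 ^+ (k - l)))
           (Ecoef b l k *: fps_of_mpoly ('X_1 ^+ l * 'X_0 ^+ (k - l))).
  by rewrite Efield_radial radialZ.
rewrite (eq_bigr _ (fun l _ => E l)) radial_sum; congr radial.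
  have := homog_part_sum k.+1 (fun j => if j is l.+1 then Ecoef b l k else 0).
  rewrite big_ord_recl scale0r add0r => ->.
  by apply: eq_homog_part => m mk; rewrite /Ex mk.
rewrite (homog_part_sum k (fun l => Ecoef b l k)).
by apply: eq_homog_part => m mk; rewrite /Er mk.
Qed.

Lemma FspaceP v : Fspace R v <-> exists a, v = radial (Fx a) (Fr a).
Proof.
have sumF a : is_formal_sum (Fblock a) (radial (Fx a) (Fr a)).
  rewrite (funext (Fblock_radial a)); apply: radial_formal_sum.
  by rewrite /Fx mdeg0.
split=> -[a]; last by move=> ->; exists a.
by move=> av; exists a; apply: formal_sum_unique (sumF a).
Qed.

Lemma EspaceP v : Espace R v <-> exists b, v = radial (Ex b) (Er b).
Proof.
have sumE b : is_formal_sum (Eblock b) (radial (Ex b) (Er b)).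
  rewrite (funext (Eblock_radial b)); apply: radial_formal_sum.
  by rewrite /Ex mnm0E.
split=> -[b]; last by move=> ->; exists b.
by move=> bv; exists b; apply: formal_sum_unique (sumE b).
Qed.

(** Shifting by one power of [ybar] aligns the d/dx coefficient of [F^l_k] with
    its d/drho coefficient. *)
Lemma Fx_shift a m :
  Fx a (m + U_(1))%MM = (m 0).+1%:R * Fcoef a (m 1).+1 (mdeg m).
Proof. by rewrite /Fx mdegD mdeg1 addn1 !mnmDE !mnm1E addn0 addn1. Qed.

Lemma Ex_shift b m : Ex b (m + U_(1))%MM = Er b m.
Proof. by rewrite /Ex mdegD mdeg1 mnmDE mnm1E !addn1. Qed.

(** If the two sums agree, the coefficients [c] of [F^l_k] and [e] of [E^l_k]
    satisfy [(k - l + 1) c = e = - (l + 1) c], so [(k + 2) c = 0]. *)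
Lemma Fspace_Espace_disjoint : Fspace R `&` Espace R = [set 0].
Proof.
apply/seteqP; split=> [v [/FspaceP[a va] /EspaceP[b vb]]|_ ->]; last first.
  split; [apply/FspaceP|apply/EspaceP]; exists (fun _ _ => 0).
    rewrite -radial0; congr radial; apply/funext => m; rewrite /Fx /Fr /Fcoef /=.
      by case: (mdeg m) => // k; case: (m 1) => [|l]; rewrite ?if_same mulr0.
    by rewrite if_same mulr0 oppr0.
  rewrite -radial0; congr radial; apply/funext => m; rewrite /Ex /Er /Ecoef.
    by case: (m 1) => // l; rewrite if_same.
  by rewrite if_same.
have [Fx_Ex Fr_Er] := radial_inj (etrans (esym va) vb).
have Er0 m : Er b m = 0.
  have := congr1 (fun f : fps R 2 => f (m + U_(1))%MM) Fx_Ex.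
  rewrite /= Fx_shift Ex_shift -Fr_Er /Fr => /eqP.
  rewrite -addr_eq0 -mulrDl mulf_eq0 -natrD pnatr_eq0 addnS /= => /eqP ->.
  by rewrite mulr0 oppr0.
rewrite /= vb -radial0; congr radial; apply/funext => m; rewrite ?Er0 //.
have [m1|/subU1K <-] := eqVneq (m 1) 0%N; first by rewrite /Ex m1.
by rewrite Ex_shift Er0.
Qed.

(** The coefficients at which [planar A B] has its terms [d/dybar],
    [ybar d/dybar] and [xbar d/dxbar]: what remains up to degree one is a multiple
    of [xbar d/dybar]. *)
Definition nilpotent_jet A B : Prop :=
  [/\ A 0%MM = 0, A U_(1)%MM = 0 & B 0%MM = 0].

Lemma nilpotent_jet_linear a A B A' B' :
  nilpotent_jet A B -> nilpotent_jet A' B' ->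
  nilpotent_jet (a *: A + A') (a *: B + B').
Proof.
move=> [A0 A1 B0] [A0' A1' B0']; split.
- by rewrite -[LHS]/(a * A 0%MM + A' 0%MM) A0 A0' mulr0 addr0.
- by rewrite -[LHS]/(a * A U_(1)%MM + A' U_(1)%MM) A1 A1' mulr0 addr0.
- by rewrite -[LHS]/(a * B 0%MM + B' 0%MM) B0 B0' mulr0 addr0.
Qed.

Lemma ord_ge_X0M B : ord_ge 1 B -> ord_ge 2 (fps_of_mpoly 'X_0 * B).
Proof.
move=> B1; apply: (@ord_geM _ _ 1 1) => //; apply/ord_ge1P.
by rewrite /fps_of_mpoly mcoeffX -mdeg_eq0 mdeg1.
Qed.

(** The action of a field of this kind on [A'] has order at least 2: a term
    [xbar B d/dxbar] has order 2 already, and [d/dybar A'] vanishes at the origin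
    since [A'] has no linear term in [ybar]. *)
Lemma nilpotent_jet_br A B A' B' :
  nilpotent_jet A B -> nilpotent_jet A' B' ->
  nilpotent_jet (vact (planar A B) A' - vact (planar A' B') A)
                (vact (planar A B) B' - vact (planar A' B') B).
Proof.
have act2 C D E F : nilpotent_jet C D -> nilpotent_jet E F ->
    ord_ge 2 (vact (planar C D) E) /\ ord_ge 1 (vact (planar C D) F).
  move=> [/ord_ge1P C1 _ /ord_ge1P D1] [_ E1 _].
  have dE1 : ord_ge 1 (fps_deriv 1 E).
    by apply/ord_ge1P; rewrite /fps_deriv add0m E1 mul0rn.
  rewrite /vact !sum_ord2 /planar /=; split; apply: ord_geD.
  - by apply: (@ord_geM _ _ 2 0); [exact: ord_ge_X0M|exact: ord_ge0].
  - exact: (@ord_geM _ _ 1 1).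
  - apply: (@ord_geM _ _ 1 0); last exact: ord_ge0.
    exact: ord_ge_leq (ord_ge_X0M D1).
  - by apply: (@ord_geM _ _ 1 0); last exact: ord_ge0.
move=> J J'; have [P2 P1] := act2 _ _ _ _ J J'.
have [Q2 Q1] := act2 _ _ _ _ J' J.
have S2 := ord_geB P2 Q2; have S1 := ord_geB P1 Q1.
by split; [rewrite S2 ?mdeg0|rewrite S2 ?mdeg1|rewrite S1 ?mdeg0].
Qed.

(** For each degree above the linear one the two monomial fields
    [x ^ l rho ^ (k - l) x d/dx] and [x ^ l rho ^ (k - l) rho d/drho] are
    combinations of [F^l_k] and [E^l_k], since the matrix of rows
    [(k - l + 1, - (l + 1))] and [(1, 1)] has determinant [k + 2]. The fields
    [rho ^ (k + 1) d/dx] are multiples of [F^(-1)_k]. *)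
Lemma FE_sumP v : sum_set (Fspace R) (Espace R) v <->
  exists A B, nilpotent_jet A B /\ v = radial A B.
Proof.
split=> [[_ [_ [/FspaceP[a ->] /EspaceP[b ->] ->]]]|[A [B [[A0 A1 B0] ->]]]].
  exists (Fx a + Ex b), (Fr a + Er b); split; last first.
    by rewrite radialD.
  split.
  - by rewrite -[LHS]/(Fx a _ + Ex b _) /Fx /Ex mdeg0 mnm0E addr0.
  - rewrite -[U_(1)%MM]add0m -[LHS]/(Fx a _ + Ex b _) Fx_shift Ex_shift.
    by rewrite /Er mdeg0 !mnm0E -[Fcoef a 1 0]/0 -[Ecoef b 0 0]/0 mulr0 addr0.
  - rewrite -[LHS]/(Fr a _ + Er b _) /Fr /Er mdeg0 !mnm0E.
    by rewrite -[Fcoef a 1 0]/0 -[Ecoef b 0 0]/0 mulr0 oppr0 addr0.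
pose mon i j : 'X_{1..2} := [multinom nth 0%N [:: i; j] k | k < 2].
have monE m : mon (m 0) (m 1) = m by rewrite /mon -multinom2.
(* Cramer's rule for this two by two system gives the coefficients of [F^l_k]. *)
pose alpha m := (A (m + U_(1))%MM - B m) / (mdeg m).+2%:R.
pose a (l : int) k :=
  if l is Posz l then alpha (mon (k - l)%N l) else A (mon k.+1 0%N) / k.+2%:R.
pose b l k := A (mon (k - l)%N l + U_(1))%MM - (k - l).+1%:R * a (Posz l) k.
exists (radial (Fx a) (Fr a)), (radial (Ex b) (Er b)); split.
- by apply/FspaceP; exists a.
- by apply/EspaceP; exists b.
rewrite -radialD.
have nz k : k.+2%:R != 0 :> R by rewrite pnatr_eq0.
have mon_mdeg m : mon (mdeg m - m 1%R)%N (m 1) = m by rewrite mdeg2 addnK monE.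
have m_eq0 m : (0 < mdeg m + m 1%R)%N = (m != 0%MM).
  by rewrite -mdeg_eq0 mdeg2; lia.
have FcoefE m : m != 0%MM -> Fcoef a (m 1).+1 (mdeg m) = alpha m.
  by rewrite -m_eq0 lt0n /Fcoef /a mon_mdeg => /negPf ->.
have EcoefE m : m != 0%MM ->
    Ecoef b (m 1) (mdeg m) = A (m + U_(1))%MM - (m 0).+1%:R * alpha m.
  move=> m0; rewrite /Ecoef m_eq0 m0 /b /a mon_mdeg.
  by rewrite (_ : (mdeg m - m 1%R = m 0%R)%N) // mdeg2 addnK.
congr radial; apply/funext => m; last first.
  rewrite -[RHS]/(Fr a m + Er b m) /Fr /Er.
  have [->|m0] := eqVneq m 0%MM.
    by rewrite mdeg0 !mnm0E -[Fcoef a 1 0]/0 -[Ecoef b 0 0]/0 mulr0 oppr0 addr0.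
  rewrite FcoefE // EcoefE //.
  have E : ((m 0).+1%:R + (m 1).+1%:R) * alpha m = A (m + U_(1))%MM - B m.
    by rewrite -natrD addSn addnS -mdeg2 mulrC divfK.
  transitivity (A (m + U_(1))%MM - ((m 0).+1%:R + (m 1).+1%:R) * alpha m).
    by rewrite E subKr.
  ring.
rewrite -[RHS]/(Fx a m + Ex b m).
have [m1|/subU1K <-] := eqVneq (m 1) 0%N.
  have mE : mon (m 0) 0%N = m by rewrite -[RHS]monE m1.
  rewrite /Ex m1 addr0 /Fx mdeg2 m1 addn0 /=.
  case m0: (m 0) => [|i].
    by rewrite -mE m0 -[RHS]A0; congr A; apply/mnmP;
      apply: forall_ord2; rewrite mnm0E mnmE.
  by rewrite mulrC divfK // -m0 mE.
rewrite Fx_shift Ex_shift /Er; set e := (m - U_(1))%MM.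
have [->|e0] := eqVneq e 0%MM.
  by rewrite add0m A1 mdeg0 !mnm0E -[Fcoef a 1 0]/0 -[Ecoef b 0 0]/0 mulr0 addr0.
by rewrite FcoefE // EcoefE // addrC subrK.
Qed.

(** * The isomorphism onto a planar Lie algebra *)

Lemma FE_sum_lie_algebra :
  lie_algebra (@vbracket R 3) (sum_set (Fspace R) (Espace R)).
Proof.
apply: vfield_lie_algebra => [|c u v|u v].
- by apply/FE_sumP; exists 0, 0; split; rewrite ?radial0.
- move=> /FE_sumP[A [B [J ->]]] /FE_sumP[A' [B' [J' ->]]]; apply/FE_sumP.
  exists (c *: A + A'), (c *: B + B').
  by rewrite radial_linear; split=> //; apply: nilpotent_jet_linear.
- move=> /FE_sumP[A [B [J ->]]] /FE_sumP[A' [B' [J' ->]]]; apply/FE_sumP.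
  rewrite vbracket_radial; do 2!eexists; split; last by [].
  exact: nilpotent_jet_br.
Qed.

(** The planar fields with nilpotent linear part [c xbar d/dybar] that are tangent
    to the line [xbar = 0], the image of the rotation axis. *)
Definition Lb : set (vfield R 2) :=
  [set w | exists A B, nilpotent_jet A B /\ w = planar A B].

Lemma meridian_proj_iso : lie_isomorphism (@vbracket R 3) (@vbracket R 2)
  (sum_set (Fspace R) (Espace R)) Lb (@meridian_proj R).
Proof.
split.
- split.
  + move=> _ /FE_sumP[A [B [J ->]]]; exists A, B.
    by rewrite meridian_proj_radial.
  + move=> u v; rewrite !inE.
    move=> /FE_sumP[A [B [_ ->]]] /FE_sumP[A' [B' [_ ->]]].
    by rewrite !meridian_proj_radial => /planar_inj[-> ->].
  + move=> _ [A [B [J ->]]]; exists (radial A B).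
      by apply/FE_sumP; exists A, B.
    exact: meridian_proj_radial.
- by move=> c u v _ _; apply: meridian_proj_linear.
- move=> _ _ /FE_sumP[A [B [_ ->]]] /FE_sumP[A' [B' [_ ->]]].
  by rewrite !meridian_proj_radial meridian_proj_br.
Qed.

Lemma Lb_lie_algebra : lie_algebra (@vbracket R 2) Lb.
Proof.
have [[psiL _ psi_surj] psi_lin psi_br] := meridian_proj_iso.
have L := FE_sum_lie_algebra.
apply: vfield_lie_algebra => [|c u v|u v].
- exists 0, 0; split=> //; rewrite -meridian_proj_radial radial0.
  apply/funext => i; rewrite /meridian_proj /vact big1 ?linear0 // => j _.
  by rewrite mul0r.
- move=> /psi_surj[u' Lu <-] /psi_surj[v' Lv <-]; rewrite -psi_lin //.
  exact/psiL/(lie_linear L).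
- move=> /psi_surj[u' Lu <-] /psi_surj[v' Lv <-]; rewrite -psi_br //.
  exact/psiL/(lie_br L).
Qed.

(** * The Lie algebra of Bogdanov-Takens singularities *)

Lemma BT_singularity_L_BT : BT_singularity R `<=` L_BT R.
Proof. exact: sub_gen_smallest. Qed.

Lemma L_BT_linear c u v : L_BT R u -> L_BT R v -> L_BT R (c *: u + v).
Proof. exact: lie_linear (lie_generated_vfield _) _ _ _. Qed.

Lemma BT_linear_L_BT : L_BT R (BT_linear R).
Proof. by apply: BT_singularity_L_BT; exists 0; split=> //; rewrite addr0. Qed.

(** Such a field is the difference of two Bogdanov-Takens singularities. *)
Lemma ord_ge2_L_BT (h : vfield R 2) : (forall i, ord_ge 2 (h i)) -> L_BT R h.
Proof.
move=> h2; have -> : h = -1 *: BT_linear R + (BT_linear R + h).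
  by rewrite scaleN1r addKr.
apply: L_BT_linear; first exact: BT_linear_L_BT.
by apply: BT_singularity_L_BT; exists h; split=> // i m; exact: h2.
Qed.

Lemma Lb_sub_L_BT : Lb `<=` L_BT R.
Proof.
move=> _ [A [B [[A0 A1 B0] ->]]].
pose c := A U_(0%R)%MM.
have -> : planar A B = - c *: BT_linear R + (c *: BT_linear R + planar A B).
  by rewrite scaleNr addKr.
apply: L_BT_linear; first exact: BT_linear_L_BT.
apply: ord_ge2_L_BT; apply: forall_ord2.
  rewrite -[X in ord_ge _ X]/(c *: fps_of_mpoly 0 + fps_of_mpoly 'X_0 * B).
  by rewrite raddf0 scaler0 add0r; apply: ord_ge_X0M; apply/ord_ge1P.
rewrite -[X in ord_ge _ X]/(c *: fps_of_mpoly (- 'X_0) + A) => m.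
rewrite ltnS leq_eqVlt ltnS leqn0 mdeg_eq0 => /orP[/mdeg1P[i /eqP ->]|/eqP ->];
  rewrite -[LHS]/(c * (- 'X_0)@_ _ + A _) mcoeffN mcoeffX.
  move: i; apply: forall_ord2; rewrite ?eqxx ?mulrN1 ?addNr //.
  by rewrite A1 (_ : _ == _ = false) ?oppr0 ?mulr0 ?addr0 //;
    apply/eqP => /mnmP/(_ 0); rewrite !mnm1E.
by rewrite A0 -mdeg_eq0 mdeg1 oppr0 mulr0 addr0.
Qed.

Lemma Lb_proper : Lb `<` L_BT R.
Proof.
split; first exact: Lb_sub_L_BT.
(* [ybar ^ 2 d/dxbar] is not tangent to the line [xbar = 0]. *)
pose w : vfield R 2 := fun i => nth 0 [:: fps_of_mpoly ('X_1 ^+ 2); 0] i.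
move=> /(_ w) [].
  apply: ord_ge2_L_BT; apply: forall_ord2 => //; rewrite /w /= rmorphXn /=.
  apply: (@ord_geX _ _ 1 _ 2); apply/ord_ge1P.
  by rewrite /fps_of_mpoly mcoeffX -mdeg_eq0 mdeg1.
move=> A [B [_ /(congr1 (fun v => v 0 (U_(1) *+ 2)%MM))]].
rewrite /w /planar /= fps_mulX_eq0; last by rewrite mulmnE mnm1E.
by rewrite /fps_of_mpoly mcoeffXn eqxx => /eqP; rewrite oner_eq0.
Qed.

End HopfZeroSpaces.

Theorem theorem2p5 (R : realType) :
  Fspace R `&` Espace R = [set 0%R] /\
  lie_algebra (@vbracket R 3) (sum_set (Fspace R) (Espace R)) /\
  exists (Lb : set (vfield R 2)) (psi : vfield R 3 -> vfield R 2),
    proper_lie_subalgebra (@vbracket R 2) Lb (L_BT R) /\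
    lie_isomorphism (@vbracket R 3) (@vbracket R 2)
      (sum_set (Fspace R) (Espace R)) Lb psi.
Proof.
split; first exact: Fspace_Espace_disjoint.
split; first exact: FE_sum_lie_algebra.
exists (@Lb R), (@meridian_proj R); split; last exact: meridian_proj_iso.
split; [exact: lie_generated_vfield|exact: Lb_lie_algebra|exact: Lb_proper].
Qed.
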